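(* Let $d\ge 1$ be an integer. Let $f:[0,\infty)\to[0,\infty)$ be a nonincreasing function, and let $\mu$ be the radial Borel measure on $\mathbb R^d$ defined by $$\mu(A):=\int_A f(|y|)\,d\lambda^d(y)$$ for Borel sets $A\subset\mathbb R^d$, where $\lambda^d$ is Lebesgue measure on $\mathbb R^d$ and $|\cdot|$ is the euclidean norm. Assume that $f$ is such that $0<\mu(\mathbb R^d)<\infty$. Let $c_d$ be the smallest constant appearing in the weak type $(1,1)$ inequality satisfied by the centered maximal operator $M_\mu$. Then $$c_d\ \ge\ \left(1+\frac{2\sqrt 2}{\sqrt{3\pi d}}\sqrt{1+\frac1d}\right)^{-1}\left(\frac{2}{\sqrt 3}\right)^{d/6}.$$
   Context: For $x\in\mathbb R^d$ and $r>0$, $B(x,r)$ denotes the closed euclidean ball of radius $r$ centered at $x$. Given a locally finite Borel measure $\mu$ on $\mathbb R^d$ (so compact sets have finite measure) and a locally $\mu$-integrable function $g$, the centered maximal function is $$M_\mu g(x):=\sup_{\{r>0:\ \mu(B(x,r))>0\}}\frac{1}{\mu(B(x,r))}\int_{B(x,r)}|g|\,d\mu .$$ The weak type $(1,1)$ inequality for $M_\mu$ with constant $c$ is the statement that for every $g\in L^1(\mathbb R^d,\mu)$ and every $\alpha>0$, $\alpha\,\mu(\{x: M_\mu g(x)\ge\alpha\})\le c\,\|g\|_{L^1(\mu)}$. By the Besicovitch covering theorem such a finite $c$ exists, and $c_d=c_d(\mu)$ denotes the smallest such constant. (Using $\{M_\mu g>\alpha\}$ in place of $\{M_\mu g\ge\alpha\}$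 gives the same smallest constant.) *)

(* Defs.v *)
From HB Require Import structures.
From mathcomp Require Import all_boot all_order all_algebra.
From mathcomp Require Import all_classical all_reals all_analysis.
From mathcomp Require Import measurable_realfun.

Set Implicit Arguments.
Unset Strict Implicit.
Unset Printing Implicit Defensive.
Import Order.TTheory GRing.Theory Num.Theory.
Import numFieldNormedType.Exports.
Local Open Scope classical_set_scope.
Local Open Scope ring_scope.

(* R^d, with the sigma-algebra generated by the coordinate projections, i.e.,
   the Borel sigma-algebra. *)
Notation euclidean R d := (d.-tuple (measurableTypeR R)).

Section lebesgue_step.
Context {R : realType} {n : nat}.
Variable m : {sigma_finite_measure set (euclidean R n) -> \bar R}.
Local Open Scope ereal_scope.

Definition cons_euclidean (p : measurableTypeR R * euclidean R n) :
  euclidean R n.+1 := [the n.+1.-tuple _ of p.1 :: p.2].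

Definition uncons_euclidean (x : euclidean R n.+1) :
  measurableTypeR R * euclidean R n := (thead x, [tuple of behead x]).

Lemma cons_euclideanK : cancel cons_euclidean uncons_euclidean.
Proof.
by move=> [x t]; rewrite /uncons_euclidean/= theadE; congr pair; exact/val_inj.
Qed.

Lemma measurable_cons_euclidean : measurable_fun setT cons_euclidean.
Proof. exact: measurable_cons. Qed.

Lemma measurable_uncons_euclidean : measurable_fun setT uncons_euclidean.
Proof.
by apply: measurable_fun_pair; [exact: measurable_tnth|exact: measurable_behead].
Qed.

Definition lebesgue_cons (A : set (euclidean R n.+1)) : \bar R :=
  (@lebesgue_measure R \x m) (cons_euclidean @^-1` A).

Let mpre A : measurable A -> measurable (cons_euclidean @^-1` A).
Proof. by move=> mA; rewrite -[X in measurable X]setTI; exact: measurable_cons_euclidean. Qed.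

Let lebesgue_cons0 : lebesgue_cons set0 = 0.
Proof. by rewrite /lebesgue_cons preimage_set0 measure0. Qed.

Let lebesgue_cons_ge0 A : 0 <= lebesgue_cons A.
Proof. exact: measure_ge0. Qed.

Let lebesgue_cons_sigma_additive : semi_sigma_additive lebesgue_cons.
Proof.
move=> F mF tF mUF; rewrite /lebesgue_cons preimage_bigcup.
apply: measure_semi_sigma_additive.
- by move=> k; exact: mpre.
- apply/trivIsetP => /= i j _ _ ij; rewrite -preimage_setI.
  by move/trivIsetP : tF => /(_ _ _ _ _ ij) ->//; rewrite preimage_set0.
- by rewrite -preimage_bigcup; exact: mpre.
Qed.

HB.instance Definition _ := isMeasure.Build _ _ _ lebesgue_cons
  lebesgue_cons0 lebesgue_cons_ge0 lebesgue_cons_sigma_additive.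

Let lebesgue_cons_sigma_finite : sigma_finite setT lebesgue_cons.
Proof.
have /sigma_finiteP[F [TF ndF Foo]] := sigma_finiteT (@lebesgue_measure R).
have /sigma_finiteP[G [TG ndG Goo]] := sigma_finiteT m.
exists (fun k => uncons_euclidean @^-1` (F k `*` G k)).
  apply/esym/seteqP; split=> // x _.
  have [i _ Fi] : (\bigcup_k F k) (thead x) by rewrite -TF.
  have [j _ Gj] : (\bigcup_k G k) [tuple of behead x] by rewrite -TG.
  exists (maxn i j) => //; split => /=.
    by move: Fi; exact/subsetPset/ndF/leq_maxl.
  by move: Gj; exact/subsetPset/ndG/leq_maxr.
move=> k; have [mF Fk] := Foo k; have [mG Gk] := Goo k; split.
  rewrite -[X in measurable X]setTI; apply: measurable_uncons_euclidean => //.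
  exact: measurableX.
rewrite /lebesgue_cons -comp_preimage (_ : _ \o _ = id); last first.
  by apply/funext => p /=; rewrite cons_euclideanK.
by rewrite preimage_id product_measure1E// lte_mul_pinfty// ge0_fin_numE.
Qed.

HB.instance Definition _ := Measure_isSigmaFinite.Build _ _ _ lebesgue_cons
  lebesgue_cons_sigma_finite.

End lebesgue_step.

(* Lebesgue measure on R^d, as the d-fold product of the Lebesgue measure on R *)
Fixpoint lebesgue (R : realType) (d : nat) :
    {sigma_finite_measure set (euclidean R d) -> \bar R} :=
  match d with
  | 0 => [the {sigma_finite_measure set (euclidean R 0) -> \bar R}
           of \d_([tuple] : euclidean R 0)]
  | n.+1 => [the {sigma_finite_measure set (euclidean R n.+1) -> \bar R}
              of lebesgue_cons (lebesgue R n)]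
  end.

Lemma lebesgue_box (R : realType) (d : nat) (A : 'I_d -> set (measurableTypeR R)) :
  (forall i, measurable (A i)) ->
  lebesgue R d [set x | forall i, A i (tnth x i)] =
  (\prod_(i < d) lebesgue_measure (A i))%E.
Proof.
elim: d A => [|d IH] A mA.
  rewrite big_ord0 /= diracE mem_set//; by case.
rewrite big_ord_recl /= /lebesgue_cons.
rewrite (_ : _ @^-1` _ = A ord0 `*` [set x | forall i, A (lift ord0 i) (tnth x i)]).
  have mB : measurable [set x : euclidean R d | forall i, A (lift ord0 i) (tnth x i)].
    rewrite (_ : [set _ | _] =
        \bigcap_i ((fun x : euclidean R d => tnth x i) @^-1` A (lift ord0 i))).
      apply: fin_bigcap_measurable; first exact: finite_finset.
      by move=> i _; rewrite -[X in measurable X]setTI; exact: measurable_tnth.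
    by apply/seteqP; split => x /= h i; [move=> _|]; exact: h.
  rewrite product_measure1E//; congr (_ * _)%E; exact: (IH (fun i => A (lift ord0 i))).
apply/seteqP; split => -[x t] /=.
  by move=> h; split => [|i]; [exact: (h ord0)|have := h (lift ord0 i); rewrite tnthS].
move=> [h0 h] i; case: (unliftP ord0 i) => [j|] ->; last exact: h0.
by rewrite tnthS.
Qed.

Section euclidean_norm.
Context {R : realType} {d : nat}.

Definition enorm (x : euclidean R d) : R :=
  Num.sqrt (\sum_(i < d) tnth x i ^+ 2).

Definition edist (x y : euclidean R d) : R :=
  Num.sqrt (\sum_(i < d) (tnth x i - tnth y i) ^+ 2).

Definition eball (x : euclidean R d) (r : R) : set (euclidean R d) :=
  [set y | edist x y <= r].

Lemma enorm_ge0 (x : euclidean R d) : 0 <= enorm x.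
Proof. exact: sqrtr_ge0. Qed.

Lemma measurable_enorm : measurable_fun setT enorm.
Proof.
apply: (@measurableT_comp _ _ _ _ _ _ (@Num.sqrt R)).
  by apply: nondecreasing_measurable => // s t; exact: ler_wsqrtr.
by apply: measurable_sum => i; apply: measurable_funX; exact: measurable_tnth.
Qed.

End euclidean_norm.

Section radial_measure.
Context {R : realType}.
Variables (d : nat) (f : R -> R).
Hypothesis f_ge0 : forall s : R, 0 <= s -> 0 <= f s.
Hypothesis f_noninc : forall s t : R, 0 <= s -> s <= t -> f t <= f s.
Local Open Scope ereal_scope.

(* The hypotheses on f are arguments so that the measure instance below can be
   inferred; they do not occur in the value. *)
Definition radial_measure
    of (forall s, (0 <= s -> 0 <= f s)%R)
     & (forall s t, (0 <= s -> s <= t -> f t <= f s)%R) :=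
  fun A : set (euclidean R d) => \int[lebesgue R d]_(y in A) (f (enorm y))%:E.

Local Notation mu := (radial_measure f_ge0 f_noninc).

Lemma measurable_radial :
  measurable_fun setT (fun y : euclidean R d => (f (enorm y))%:E).
Proof.
apply/measurable_EFinP.
rewrite (_ : (fun _ => _) = (fun s => f (Num.max 0%R s)) \o enorm); last first.
  by apply/funext => y /=; rewrite max_r// enorm_ge0.
apply: measurableT_comp; last exact: measurable_enorm.
apply: nonincreasing_measurable => // s t st; apply: f_noninc.
  by rewrite le_max lexx.
by rewrite ge_max !le_max lexx st orbT.
Qed.

Let mu0 : mu set0 = 0.
Proof. exact: integral_set0. Qed.

Let mu_ge0 A : 0 <= mu A.
Proof. by apply: integral_ge0 => y _; rewrite lee_fin f_ge0 ?enorm_ge0. Qed.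

Let mu_sigma_additive : semi_sigma_additive mu.
Proof.
move=> F mF tF mUF; rewrite [X in _ --> X]ge0_integral_bigcup//.
- by apply: is_cvg_nneseries => n _ _; exact: mu_ge0.
- by apply: measurable_funTS; exact: measurable_radial.
- by move=> y _; rewrite lee_fin f_ge0 ?enorm_ge0.
Qed.

HB.instance Definition _ := isMeasure.Build _ _ _ mu
  mu0 mu_ge0 mu_sigma_additive.

End radial_measure.
Arguments radial_measure {R} d {f}.

Section maximal_function.
Context {R : realType} {d : nat}.
Variable mu : {measure set (euclidean R d) -> \bar R}.
Local Open Scope ereal_scope.

Definition maximal_function (g : euclidean R d -> R) (x : euclidean R d) :
    \bar R :=
  ereal_sup [set (mu (eball x r))^-1 * \int[mu]_(y in eball x r) `|(g y)%:E|
            | r in [set r : R | (0 < r)%R /\ 0 < mu (eball x r)]].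

Definition weak_type11 (c : R) : Prop :=
  forall g : euclidean R d -> R, mu.-integrable setT (EFin \o g) ->
  forall alpha : R, (0 < alpha)%R ->
    alpha%:E * mu [set x | alpha%:E <= maximal_function g x] <=
    c%:E * \int[mu]_x `|(g x)%:E|.

(* The smallest constant (see weak_type11_constantP); +oo if there is none. *)
Definition weak_type11_constant : \bar R :=
  ereal_inf [set c%:E | c in weak_type11].

Lemma weak_type11_constantP (c : R) :
  weak_type11 c <-> weak_type11_constant <= c%:E.
Proof.
split=> [wc|cdc g ig a a0]; first by apply: ereal_inf_lbound; exists c.
have Nfin : \int[mu]_x `|(g x)%:E| \is a fin_num.
  by apply: integrable_fin_num => //; exact: integrable_abse.
have N0 : 0 <= \int[mu]_x `|(g x)%:E| by exact: integral_ge0.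
move: Nfin N0; case E : (integral _ _ _) => [N||]// _; rewrite lee_fin => N0.
apply/lee_addgt0Pr => e e0.
have N1 : (0 < N + 1)%R by rewrite ltr_wpDl.
have : weak_type11_constant < (c + e / (N + 1))%:E.
  by rewrite (le_lt_trans cdc)// lte_fin ltrDl divr_gt0.
move=> /ereal_inf_lt[_ [c' wc' <-]]; rewrite lte_fin => c'c.
apply: (le_trans (wc' g ig a a0)); rewrite E -EFinM -EFinD lee_fin.
rewrite (le_trans (ler_wpM2r N0 (ltW c'c)))// mulrDl lerD2l.
by rewrite mulrAC ler_pdivrMr// ler_pM2l// lerDl.
Qed.

End maximal_function.

(* Main.v *)
(** For [enorm x <= rho] the ball of center [x] and radius slightly larger than
    [enorm x] contains a small ball around the origin, so testing the weak type
    inequality on the indicator of that small ball gives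
      [mu (B(0, rho)) <= c * sup_{|x| <= rho} mu (B(x, |x|+))].
    Two bounds of the right-hand side are used.
    - [B(x, |x|)] and its mirror image meet only at the origin, whence [c >= 2];
      this settles [d <= 34].
    - For [d >= 35], choose [rho] (almost) maximizing [mu (B(0, s)) / s ^ (d/4)],
      a bounded function of [s] since the density is bounded and the measure is
      finite. This controls the mass of every [B(0, s)] by that of [B(0, rho)].
      Then cut [B(x, |x|)] at the radii [rho] and [sqrt 2 * rho]: the inner part
      lies in a ball of radius [sqrt 3 / 2 * rho], and each of the outer parts in
      a cone, which meets each [B(0, s)] in a set covered by a smaller ball. Since
      the density is radially nonincreasing, these comparisons of Lebesgue measures
      on the balls [B(0, s)] transfer to [mu]. *)
From HB Require Import structures.
Require Import Defs.
From mathcomp Require Import all_boot all_order all_algebra.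
From mathcomp Require Import all_classical all_reals all_analysis.
From mathcomp Require Import measurable_realfun ring lra.

Set Implicit Arguments.
Unset Strict Implicit.
Unset Printing Implicit Defensive.

Import Order.TTheory GRing.Theory Num.Theory.
Import numFieldNormedType.Exports.
Import Defs.
Local Open Scope classical_set_scope.
Local Open Scope ring_scope.

(** * Lebesgue measure under homotheties and translations *)

Section affine_change.
Context {R : realType}.
Implicit Types (a b : R).
Local Open Scope ereal_scope.

(** By uniqueness of Lebesgue measure it is enough to compare both sides on half-open intervals; a
    negative [a] swaps the closed and the open end. *)
Lemma lebesgue_measure_affine a b (A : set (measurableTypeR R)) :
  (a != 0)%R -> measurable A ->
  `|a|%:E * lebesgue_measure ((fun t : measurableTypeR R => a * t + b)%R @^-1` A)
  = lebesgue_measure A.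
Proof.
move=> a0 mA; pose phi (t : measurableTypeR R) : measurableTypeR R := (a * t + b)%R.
have mphi : measurable_fun setT phi.
  apply: measurable_funD => //; exact: measurable_funM.
have na0 : (0 <= `|a|)%R by [].
pose m := mscale (NngNum na0) (pushforward (@lebesgue_measure R) phi).
suff mE : forall X, ocitv X -> lebesgue_measure X = m mphi X.
  by rewrite (@lebesgue_measure_unique R (m mphi) mE A mA).
move=> _ [[u v] _ <-] /=; rewrite /m/= /mscale/= /pushforward/=.
have [aN|aP] : (a < 0 \/ 0 < a)%R by apply/orP; rewrite -neq_lt.
  rewrite (_ : _ @^-1` _ = `[((v - b) / a)%R, ((u - b) / a)%R[%classic); last first.
    apply/seteqP; split => t /=; rewrite !in_itv/= ler_ndivrMr// ltr_ndivlMr//;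
      rewrite /phi => /andP[h1 h2]; apply/andP; split; lra.
  rewrite !lebesgue_measure_itv/= !lte_fin ltr_ndivrMr// divfK// ltrD2r.
  case: ifPn => [uv|_]; last by rewrite mule0.
  by rewrite -!EFinB -EFinM ltr0_norm//; congr EFin; field.
rewrite (_ : _ @^-1` _ = `]((u - b) / a)%R, ((v - b) / a)%R]%classic); last first.
  apply/seteqP; split => t /=; rewrite !in_itv/= ler_pdivlMr// ltr_pdivrMr//;
      rewrite /phi => /andP[h1 h2]; apply/andP; split; lra.
rewrite !lebesgue_measure_itv/= !lte_fin ltr_pdivrMr// divfK// ltrD2r.
case: ifPn => [uv|_]; last by rewrite mule0.
by rewrite -!EFinB -EFinM gtr0_norm//; congr EFin; field.
Qed.

Definition affine d a (b : euclidean R d) (x : euclidean R d) : euclidean R d :=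
  [tuple (a * tnth x i + tnth b i)%R | i < d].

Lemma measurable_affine d a (b : euclidean R d) : measurable_fun setT (affine a b).
Proof.
apply/measurable_fun_tnthP => i.
rewrite (_ : _ \o _ = fun x => (a * tnth x i + tnth b i)%R); last first.
  by apply/funext => x /=; rewrite tnth_mktuple.
by apply: measurable_funD => //; apply: measurable_funM => //; exact: measurable_tnth.
Qed.

(** Induction on [d]: the rescaled pushforward agrees with the product measure on rectangles, by the
    one-dimensional case and the induction hypothesis, hence everywhere. *)
Lemma lebesgue_affine d a (b : euclidean R d) (A : set (euclidean R d)) :
  (a != 0)%R -> measurable A ->
  (`|a| ^+ d)%:E * lebesgue R d (affine a b @^-1` A) = lebesgue R d A.
Proof.
move=> a0; elim: d b A => [|d IH] b A mA.
  rewrite expr0 mul1e (_ : affine a b @^-1` A = A)//.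
  by apply/seteqP; split => x /=; rewrite [affine _ _ _]tuple0 [x]tuple0.
have mphi : measurable_fun setT
    (fun p : measurableTypeR R * euclidean R d =>
       ((a * p.1 + thead b)%R : measurableTypeR R, affine a [tuple of behead b] p.2)).
  apply: measurable_fun_pair.
    by apply: measurable_funD => //; apply: measurable_funM.
  by apply: (measurableT_comp (measurable_affine _ _)).
set phi := (fun p => _) in mphi.
have na0 : (0 <= `|a| ^+ d.+1)%R by rewrite exprn_ge0.
pose m := mscale (NngNum na0)
  (pushforward (@lebesgue_measure R \x lebesgue R d)%E phi).
have mC : measurable (@cons_euclidean R d @^-1` A).
  by rewrite -[X in measurable X]setTI; exact: measurable_cons_euclidean.
rewrite /= /lebesgue_cons [RHS](@product_measure_unique _ _ _ _ _ _ _ (m mphi))//.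
  rewrite /m/= /mscale/= /pushforward/=; congr (_ * _).
  suff E t x : affine a b (cons_euclidean (t, x)) = cons_euclidean (phi (t, x)).
    by congr (product_measure1 _ _ _); apply/seteqP; split => -[t x] /=; rewrite E.
  apply: eq_from_tnth => i; rewrite tnth_mktuple.
  case: (unliftP ord0 i) => [j|] ->; last by rewrite !tnth0.
  rewrite /cons_euclidean/= !tnthS tnth_mktuple tnth_behead; congr (_ + tnth _ _)%R.
  by apply/val_inj; rewrite /= inordK// ltnS.
move=> X Y mX mY; rewrite /m/= /mscale/= /pushforward/=.
rewrite (_ : _ @^-1` _ = ((fun t : measurableTypeR R => a * t + thead b)%R @^-1` X)
   `*` (affine a [tuple of behead b] @^-1` Y))//.
rewrite product_measure1E//; last 2 first.
- rewrite -[X in measurable X]setTI.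
  have : measurable_fun setT (fun t : measurableTypeR R => (a * t + thead b)%R : measurableTypeR R).
    by apply: measurable_funD => //; apply: measurable_funM.
  by apply.
- by rewrite -[X in measurable X]setTI; exact: measurable_affine.
rewrite -(lebesgue_measure_affine (thead b) a0 mX) -(IH [tuple of behead b] Y mY).
by rewrite exprS EFinM muleACA.
Qed.

End affine_change.

(** * Inner product, balls and their measurability *)

Section euclidean_geometry.
Context {R : realType} {d : nat}.
Implicit Types (x y z : euclidean R d) (r a : R).

Definition dot x y : R := \sum_(i < d) tnth x i * tnth y i.

Definition scale a x : euclidean R d := [tuple a * tnth x i | i < d].

Definition ball0 r : set (euclidean R d) := [set y | enorm y <= r].

Lemma enorm_sqr x : enorm x ^+ 2 = dot x x.
Proof. by rewrite sqr_sqrtr ?sumr_ge0// => i _; exact: sqr_ge0. Qed.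

Lemma edist_sqr x y : edist x y ^+ 2 = enorm x ^+ 2 - 2 * dot x y + enorm y ^+ 2.
Proof.
rewrite sqr_sqrtr ?sumr_ge0// => [|i _]; last exact: sqr_ge0.
rewrite !enorm_sqr /dot mulr_sumr -sumrB -big_split/=.
by apply: eq_bigr => i _; ring.
Qed.

Lemma edist_ge0 x y : 0 <= edist x y.
Proof. exact: sqrtr_ge0. Qed.

(** Turns membership in a ball into a polynomial inequality in norms and inner products, so that
    inclusions of balls become real arithmetic. *)
Lemma le_edist x y r : 0 <= r ->
  (edist x y <= r) = (enorm x ^+ 2 - 2 * dot x y + enorm y ^+ 2 <= r ^+ 2).
Proof. by move=> r0; rewrite -edist_sqr ler_sqr ?nnegrE ?edist_ge0. Qed.

Lemma dot_scalel a x y : dot (scale a x) y = a * dot x y.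
Proof. by rewrite /dot mulr_sumr; apply: eq_bigr => i _; rewrite tnth_mktuple mulrA. Qed.

Lemma dot_scaler a x y : dot y (scale a x) = a * dot y x.
Proof. by rewrite /dot mulr_sumr; apply: eq_bigr => i _; rewrite tnth_mktuple mulrCA. Qed.

Lemma enorm_scale_sqr a x : enorm (scale a x) ^+ 2 = a ^+ 2 * enorm x ^+ 2.
Proof. by rewrite !enorm_sqr dot_scalel dot_scaler; ring. Qed.

(** Cauchy-Schwarz, from the nonnegativity in [a] of the squared distance between [x] and
    [scale a y]. *)
Lemma dot_le x y : `|dot x y| <= enorm x * enorm y.
Proof.
have h a : 0 <= enorm x ^+ 2 - 2 * (a * dot x y) + a ^+ 2 * enorm y ^+ 2.
  by rewrite -enorm_scale_sqr -dot_scaler -edist_sqr sqr_ge0.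
rewrite -ler_sqr ?nnegrE ?mulr_ge0 ?enorm_ge0// real_normK ?num_real//.
have [y0|y0] := eqVneq (enorm y) 0.
  suff -> : dot x y = 0 by rewrite y0; lra.
  apply/eqP/negP => /negP xy0.
  (* Here the quadratic degenerates to an affine function of [a]; this [a] gives it the value -1. *)
  have := h ((enorm x ^+ 2 + 1) / (2 * dot x y)); rewrite y0 expr0n/= mulr0 addr0.
  rewrite [X in _ - X](_ : _ = enorm x ^+ 2 + 1); [lra|by field].
have y1 : 0 < enorm y ^+ 2 by rewrite exprn_gt0// lt_def y0 enorm_ge0.
(* The minimizer of the quadratic. *)
have := h (dot x y / enorm y ^+ 2).
rewrite (_ : _ + _ = enorm x ^+ 2 - dot x y ^+ 2 / enorm y ^+ 2); last by field.
by rewrite subr_ge0 ler_pdivrMr// exprMn.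
Qed.

Lemma measurable_dot x : measurable_fun setT (dot x).
Proof.
apply: measurable_sum => i; apply: measurable_funM => //; exact: measurable_tnth.
Qed.

Lemma measurable_ball0 r : measurable (ball0 r).
Proof.
rewrite (_ : ball0 r = setT `&` enorm @^-1` `]-oo, r]); last first.
  by apply/seteqP; split=> y /=; rewrite in_itv/= => // -[].
exact: measurable_enorm.
Qed.

Lemma measurable_eball x r : measurable (eball x r).
Proof.
have mf : measurable_fun setT (edist x).
  apply: (@measurableT_comp _ _ _ _ _ _ (@Num.sqrt R)).
    by apply: nondecreasing_measurable => // s t; exact: ler_wsqrtr.
  apply: measurable_sum => i; apply: measurable_funX.
  by apply: measurable_funB => //; exact: measurable_tnth.
rewrite (_ : eball x r = setT `&` edist x @^-1` `]-oo, r]); first exact: mf.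
by apply/seteqP; split=> y /=; rewrite in_itv/= => // -[].
Qed.

Lemma ball0_subset r s : r <= s -> ball0 r `<=` ball0 s.
Proof. by move=> rs y /=; rewrite /ball0/= => /le_trans; exact. Qed.

End euclidean_geometry.

(** * Lebesgue measure of balls *)

Section lebesgue_balls.
Context {R : realType} {d : nat}.
Implicit Types (x y z : euclidean R d) (r a : R).
Local Open Scope ereal_scope.

Lemma lebesgue_eball x r : lebesgue R d (eball x r) = lebesgue R d (ball0 r).
Proof.
rewrite -(@lebesgue_affine R d 1 x (eball x r)) ?oner_eq0//; last exact: measurable_eball.
rewrite normr1 expr1n mul1e; congr (lebesgue R d _).
have E y : edist x (affine 1 x y) = enorm y.
  rewrite /edist /enorm; congr Num.sqrt; apply: eq_bigr => i _.
  by rewrite tnth_mktuple mul1r opprD addrCA subrr addr0 sqrrN.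
by apply/seteqP; split => y; rewrite /eball /ball0 /= E.
Qed.

Lemma lebesgue_ball0_scale r a : (0 < a)%R ->
  lebesgue R d (ball0 (a * r)) = (a ^+ d)%:E * lebesgue R d (ball0 r).
Proof.
move=> a0; rewrite -(@lebesgue_affine R d a [tuple 0%R | i < d] (ball0 (a * r))); last 2 first.
- by rewrite gt_eqF.
- exact: measurable_ball0.
rewrite gtr0_norm//; congr (_ * lebesgue R d _).
rewrite /ball0 [affine _ _](_ : _ = scale a); last first.
  by apply/funext => y; apply: eq_from_tnth => i; rewrite !tnth_mktuple addr0.
have E y : enorm (scale a y) = (a * enorm y)%R.
  apply/eqP; rewrite -(@eqrXn2 _ 2) ?mulr_ge0 ?enorm_ge0 ?(ltW a0)//.
  by rewrite enorm_scale_sqr exprMn.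
by apply/seteqP; split => y /=; rewrite E ler_pM2l.
Qed.

Lemma lebesgue_opp (A : set (euclidean R d)) : measurable A ->
  lebesgue R d (scale (-1) @^-1` A) = lebesgue R d A.
Proof.
move=> mA; rewrite -[RHS](@lebesgue_affine R d (-1) [tuple 0%R | i < d]) ?oppr_eq0 ?oner_eq0//.
rewrite normrN1 expr1n mul1e; congr (lebesgue R d _).
have -> : affine (-1) [tuple 0%R | i < d] = @scale R d (-1); last by [].
by apply/funext => y; apply: eq_from_tnth => i; rewrite !tnth_mktuple addr0.
Qed.

(** The ball lies in the cube [[-r, r]^d], whose measure is a finite product of lengths. *)
Lemma lebesgue_ball0_fin r : lebesgue R d (ball0 r) < +oo.
Proof.
have mI i : measurable ((fun _ : 'I_d => `[(- r)%R, r]%classic : set (measurableTypeR R)) i) by [].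
apply: (@le_lt_trans _ _ (lebesgue R d [set x | forall i, `[(- r)%R, r]%classic (tnth x i)])).
  apply: le_measure; rewrite ?inE; first exact: measurable_ball0.
    rewrite (_ : [set _ | _] =
        \bigcap_i ((fun x : euclidean R d => tnth x i) @^-1` `[(- r)%R, r]%classic)).
      apply: fin_bigcap_measurable; first exact: finite_finset.
      by move=> i _; rewrite -[X in measurable X]setTI; exact: measurable_tnth.
    by apply/seteqP; split => x /= h i; [move=> _|]; exact: h.
  move=> y; rewrite /ball0/= => yr i; rewrite in_itv/= -ler_norml.
  apply: le_trans yr; rewrite -sqrtr_sqr ler_wsqrtr// (bigD1 i)//= lerDl sumr_ge0// => j _.
  exact: sqr_ge0.
rewrite (lebesgue_box mI) /= lebesgue_measure_itv/=.
set c := if _ then _ else _.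
have : \prod_(i < d) c \is a fin_num.
  by apply: prode_fin_num => i _; rewrite /c; case: ifP.
by rewrite fin_numElt => /andP[].
Qed.

End lebesgue_balls.

(** * Layer cake formula and transfer of Lebesgue comparisons to the radial measure *)

Section layer_cake.
Context {R : realType}.

(** Lets an open or closed ball around the origin be written as a countable increasing union of
    closed ones. Three cases: [I] has a maximum (constant sequence), is bounded without maximum
    (approach the supremum), or is unbounded (the integers). *)
Lemma cofinal_seq (I : set R) : I !=set0 -> I `<=` [set x | 0 <= x] ->
  (forall x y, 0 <= x -> x <= y -> I y -> I x) ->
  exists s : R^nat, [/\ nondecreasing_seq s, forall n, I (s n) &
    forall x, I x -> exists n, x <= s n].
Proof.
move=> [x0 Ix0] I0 Idown.
have [[m [Im mmax]]|nomax] := pselect (exists m, I m /\ forall x, I x -> x <= m).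
  by exists (fun _ => m); split => // x /mmax; exists 0%N.
have {}nomax x : I x -> exists2 y, I y & x < y.
  move=> Ix; apply/not_exists2P => H; apply: nomax; exists x; split => // y Iy.
  by have [] := H y => // /negP; rewrite -leNgt.
have [ubI|nubI] := pselect (has_ubound I).
  have supI : has_sup I by split => //; exists x0.
  have lt_sup x : I x -> x < sup I.
    by move=> /nomax[y Iy xy]; apply: lt_le_trans xy _; exact: ub_le_sup.
  exists (fun n => Num.max 0 (sup I - n.+1%:R^-1)); split.
  - move=> m n mn; rewrite ge_max !le_max lexx/=; apply/orP; right.
    by rewrite lerD2l lerN2 lef_pV2 ?posrE// ler_nat.
  - move=> n; have e0 : 0 < n.+1%:R^-1 :> R by rewrite invr_gt0.
    have [y Iy sy] := sup_adherent e0 supI.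
    apply: (Idown _ y) => //; first by rewrite le_max lexx.
    by rewrite ge_max I0//= ltW.
  move=> x /lt_sup xs; exists (Num.truncn (sup I - x)^-1).
  rewrite le_max; apply/orP; right; rewrite lerBrDr -lerBrDl.
  rewrite invf_ple ?posrE ?subr_gt0//.
  by apply/ltW; rewrite truncnS_gt.
exists (fun n => n%:R); split.
- by move=> m n mn; rewrite ler_nat.
- move=> n; have [y Iy ny] : exists2 y, I y & n%:R < y.
    apply/not_exists2P => H; apply: nubI; exists n%:R => y Iy.
    by have [] := H y => // /negP; rewrite -leNgt.
  by apply: (Idown _ y) => //; exact: ltW.
- by move=> x Ix; exists (Num.truncn x).+1; apply/ltW; exact: truncnS_gt.
Qed.


Variables (d : nat) (f : R -> R).
Hypothesis f_ge0 : forall s : R, 0 <= s -> 0 <= f s.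
Hypothesis f_noninc : forall s t : R, 0 <= s -> s <= t -> f t <= f s.
Local Open Scope ereal_scope.

Let mu := radial_measure d f_ge0 f_noninc.
(** The condition [0 <= t] empties the set at negative heights, so that the layer cake integral can
    run over the whole line. *)
Let superlevel (t : R) : set (euclidean R d) :=
  [set y | (0 <= t)%R /\ (t < f (enorm y))%R].

Let measurable_f : measurable_fun setT (fun y : euclidean R d => f (enorm y)).
Proof. by apply/measurable_EFinP; exact: measurable_radial. Qed.

Let hypograph (D : set (euclidean R d)) : set (euclidean R d * measurableTypeR R) :=
  [set p | [/\ D p.1, (0 <= p.2)%R & (p.2 < f (enorm p.1))%R]].

Let measurable_hypograph D : measurable D -> measurable (hypograph D).
Proof.
move=> mD.
pose h1 (p : euclidean R d * measurableTypeR R) := (0 <= p.2)%R.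
pose h2 (p : euclidean R d * measurableTypeR R) := (p.2 < f (enorm p.1))%R.
rewrite (_ : hypograph D = (fst @^-1` D) `&`
    ((h1 @^-1` [set true]) `&` (h2 @^-1` [set true]))); last first.
  apply/seteqP; rewrite /h1/h2; split => p /=; first by case=> ? ? ?.
  by case=> ? [? ?].
apply: measurableI; first by rewrite -[X in measurable X]setTI; exact: measurable_fst.
apply: measurableI.
  have : measurable_fun setT h1 by exact: measurable_fun_ler.
  by move=> /(_ measurableT [set true]); rewrite setTI; exact.
have : measurable_fun setT h2.
  apply: measurable_fun_ltr => //.
  exact: (measurableT_comp measurable_f).
by move=> /(_ measurableT [set true]); rewrite setTI; exact.
Qed.

Let ysection_hypograph D t : ysection (hypograph D) t = D `&` superlevel t.
Proof.
by apply/seteqP; split => y; rewrite /ysection/= inE; [case|case=> ? []].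
Qed.

Let measurable_superlevel t : measurable (superlevel t).
Proof.
rewrite -[superlevel t]setTI -ysection_hypograph.
by apply: measurable_ysection; exact: measurable_hypograph.
Qed.

Let measurable_fun_superlevel D : measurable D ->
  measurable_fun setT (fun t : measurableTypeR R => lebesgue R d (D `&` superlevel t)).
Proof.
move=> mD; under eq_fun do rewrite -ysection_hypograph.
exact: (measurable_fun_ysection (lebesgue R d) (measurable_hypograph mD)).
Qed.

(** Tonelli for the indicator of the region under the graph of the density over [D]: sections at a
    point are intervals [[0, f (enorm y)[], sections at a height are superlevel sets. *)
Lemma radial_layer_cake D : measurable D ->
  mu D = \int[@lebesgue_measure R]_t lebesgue R d (D `&` superlevel t).
Proof.
move=> mD; have mE := measurable_hypograph mD.
have := @indic_fubini_tonelli _ _ _ _ _ (lebesgue R d) (@lebesgue_measure R) _ mE.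
rewrite indic_fubini_tonelli_FE// indic_fubini_tonelli_GE//.
have -> : \int[lebesgue R d]_x (@lebesgue_measure R \o xsection (hypograph D)) x = mu D.
  rewrite /mu /radial_measure [RHS]integral_mkcond; apply: eq_integral => y _ /=.
  rewrite patchE; case: ifPn => yD.
    rewrite (_ : xsection (hypograph D) y = `[0%R, f (enorm y)[%classic); last first.
      apply/seteqP; split => t; rewrite /xsection/= inE in_itv/=.
        by case=> /= _ -> ->.
      by move=> /andP[t0 tf]; split => //; exact: set_mem.
    rewrite lebesgue_measure_itv/= lte_fin; case: ifPn => [_|]; first by rewrite sube0.
    rewrite -leNgt => f0; congr EFin; apply/eqP; rewrite eq_le f0 andbT.
    by rewrite f_ge0// enorm_ge0.
  rewrite (_ : xsection (hypograph D) y = set0) ?measure0//.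
  apply/seteqP; split => t //; rewrite /xsection/= inE => -[] /= yD'.
  by move: yD; rewrite notin_setE.
by move=> ->; apply: eq_integral => t _ /=; rewrite ysection_hypograph.
Qed.

(* Superlevel sets of the density are increasing unions of closed balls around
   the origin, so a comparison on such balls carries over to [mu]. *)
Lemma radial_compare (K : R) (D D' : set (euclidean R d)) : (0 <= K)%R ->
  measurable D -> measurable D' ->
  (forall s, (0 <= s)%R ->
     lebesgue R d (D `&` ball0 s) <= K%:E * lebesgue R d (D' `&` ball0 s)) ->
  mu D <= K%:E * mu D'.
Proof.
move=> K0 mD mD' H.
have key t : lebesgue R d (D `&` superlevel t) <=
    K%:E * lebesgue R d (D' `&` superlevel t).
  (* The radii of the points of the superlevel set; downward closed because [f] is nonincreasing. *)
  pose I : set R := [set s | [/\ 0 <= s, 0 <= t & t < f s]%R].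
  have [I0|/set0P I0] := eqVneq I set0.
    rewrite (_ : superlevel t = set0) ?setI0 ?measure0 ?mule0//.
    apply/seteqP; split => // y [t0 ty].
    have : I (enorm y) by split => //; exact: enorm_ge0.
    by rewrite I0.
  have [| |s [snd sI scof]] := @cofinal_seq I I0; first by move=> s [].
    move=> x y x0 xy [y0 t0 ty]; split => //; apply: lt_le_trans ty _.
    exact: f_noninc.
  have UE : superlevel t = \bigcup_n ball0 (s n).
    apply/seteqP; split => [y [t0 ty]|y [n _]].
      have [|n ny] := scof (enorm y); first by split => //; exact: enorm_ge0.
      by exists n.
    rewrite /ball0/= => ysn; have [s0 t0 tf] := sI n; split => //.
    by apply: lt_le_trans tf _; apply: f_noninc => //; exact: enorm_ge0.
  (* Continuity from below along these balls lets the hypothesis [H] pass to the limit. *)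
  have cv : lebesgue R d (D `&` ball0 (s n)) @[n --> \oo] -->
      lebesgue R d (D `&` superlevel t).
    rewrite UE setI_bigcupr.
    apply: (@nondecreasing_cvg_mu _ _ _ _ (fun n => D `&` ball0 (s n))).
    - by move=> n; apply: measurableI => //; exact: measurable_ball0.
    - by rewrite -setI_bigcupr -UE; exact: measurableI.
    - move=> m n mn; apply/subsetPset; apply: setIS; apply: ball0_subset; exact: snd.
  rewrite -(cvg_lim _ cv)//; apply: lime_le; first by apply/cvg_ex; eexists; exact: cv.
  apply: nearW => n; apply: le_trans (H _ _) _; first by have [] := sI n.
  apply: lee_wpmul2l; first by rewrite lee_fin.
  apply: le_measure; rewrite ?inE.
  - by apply: measurableI => //; exact: measurable_ball0.
  - exact: measurableI.
  - by apply: setIS; rewrite UE => y yn; exists n.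
rewrite !radial_layer_cake//.
rewrite -ge0_integralZl//; last exact: measurable_fun_superlevel.
apply: ge0_le_integral => //; first exact: measurable_fun_superlevel.
by apply: measurable_funeM; exact: measurable_fun_superlevel.
Qed.

End layer_cake.

(** * Mass of balls and cones under the radial measure *)

Section radial_estimates.
Context {R : realType} {d : nat} {f : R -> R}.
Hypothesis f_ge0 : forall s : R, 0 <= s -> 0 <= f s.
Hypothesis f_noninc : forall s t : R, 0 <= s -> s <= t -> f t <= f s.
Implicit Types (x y z : euclidean R d) (r s : R) (A B : set (euclidean R d)).
Local Open Scope ereal_scope.

Let mu := radial_measure d f_ge0 f_noninc.

(* No measurability is assumed: the level sets of the maximal function are not
   known to be measurable. *)
Lemma radial_le A B : A `<=` B -> mu A <= mu B.
Proof.
have f0 y : 0 <= (f (enorm y))%:E by rewrite lee_fin f_ge0// enorm_ge0.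
move=> AB; rewrite /mu /radial_measure !ge0_integralE//.
(* The integral is a supremum over simple functions below the integrand, and the larger set admits
   more of them. *)
apply: ereal_sup_le => _ [h hA <-]; exists h => // y.
apply: le_trans (hA y) _; rewrite !patchE; case: ifPn => [yA|_].
  by rewrite mem_set//; apply: AB; exact: set_mem.
by case: ifP.
Qed.

Lemma ball0I r s : ball0 r `&` ball0 s = ball0 (Num.min r s) :> set (euclidean R d).
Proof. by apply/seteqP; split => y /=; rewrite /ball0/= le_min => /andP. Qed.

(** Intersected with [ball0 s], the off-center ball has Lebesgue measure at most that of the smaller
    of the two balls, which is exactly what the centered ball achieves. *)
Lemma radial_eball_le z r : mu (eball z r) <= mu (ball0 r).
Proof.
rewrite -[leRHS]mul1e; apply: (@radial_compare _ _ _ f_ge0 f_noninc 1) => //.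
- exact: measurable_eball.
- exact: measurable_ball0.
move=> s s0; rewrite mul1e ball0I.
have [rs|sr] := leP r s.
  rewrite -(lebesgue_eball z); apply: le_measure; rewrite ?inE.
  - by apply: measurableI; [exact: measurable_eball|exact: measurable_ball0].
  - exact: measurable_eball.
  - exact: subIsetl.
apply: le_measure; rewrite ?inE.
- by apply: measurableI; [exact: measurable_eball|exact: measurable_ball0].
- exact: measurable_ball0.
- exact: subIsetr.
Qed.

(** The norm of [x] is not divided out: for [enorm x <= rho] and [0 <= c], a nonzero point of
    [cone x (c * rho)] makes with [x] an angle of cosine at least [c], and no case distinction on
    [x = 0] is required. *)
Definition cone x (c : R) : set (euclidean R d) := [set y | (c * enorm y <= dot x y)%R].

Lemma measurable_cone x c : measurable (cone x c).
Proof.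
pose h (y : euclidean R d) := (c * enorm y <= dot x y)%R.
have : measurable_fun setT h.
  apply: measurable_fun_ler; last exact: measurable_dot.
  by apply: measurable_funM => //; exact: measurable_enorm.
by move=> /(_ measurableT [set true]); rewrite setTI; exact.
Qed.

(* For [2 * c ^+ 2 <= 1] the truncated cone of aperture [arccos c] is contained in
   a ball of radius [s * sqrt (1 - c ^+ 2)] centered on its axis. *)
Lemma cone_ball0_subset x (rho c s : R) : (0 < rho)%R -> (enorm x <= rho)%R ->
  (0 <= c)%R -> (2 * c ^+ 2 <= 1)%R -> (0 <= s)%R ->
  cone x (c * rho) `&` ball0 s
    `<=` eball (scale (c * s / rho) x) (Num.sqrt (1 - c ^+ 2) * s).
Proof.
move=> rho0 xrho c0 c1 s0 y [] /=; rewrite /ball0/= => yc ys.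
have y0 := enorm_ge0 y; have x0 := enorm_ge0 x.
rewrite /eball/= le_edist; last by rewrite mulr_ge0 ?sqrtr_ge0.
rewrite exprMn [X in (_ <= X * _)%R]sqr_sqrtr; last lra.
rewrite enorm_scale_sqr dot_scalel !exprMn exprVn.
have h1 : (c ^+ 2 * s ^+ 2 * (rho ^+ 2)^-1 * enorm x ^+ 2 <= c ^+ 2 * s ^+ 2)%R.
  rewrite -mulrA ler_piMr ?mulr_ge0 ?sqr_ge0// mulrC ler_pdivrMr ?exprn_gt0//.
  by rewrite mul1r ler_sqr ?nnegrE// ltW.
have h2 : (c ^+ 2 * s * enorm y <= c * s / rho * dot x y)%R.
  rewrite [leLHS](_ : _ = c * s / rho * (c * rho * enorm y))%R.
    by rewrite ler_wpM2l// divr_ge0 ?mulr_ge0// ltW.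
  by field; rewrite gt_eqF.
(* This product is the slack left in the squared radius after [h1] and [h2]; its second factor is
   nonnegative because [2 * c ^+ 2 <= 1]. *)
have h3 : (0 <= (s - enorm y) * (s + enorm y - 2 * c ^+ 2 * s))%R.
  by rewrite mulr_ge0 ?subr_ge0// -[leLHS]addr0 lerD// ler_piMl.
move: h1 h2; set A := (_ * enorm x ^+ 2)%R; set B := (_ * dot x y)%R => h1 h2.
have -> : ((1 - c ^+ 2) * s ^+ 2 = c ^+ 2 * s ^+ 2 - 2 * (c ^+ 2 * s * enorm y)
    + enorm y ^+ 2 + (s - enorm y) * (s + enorm y - 2 * c ^+ 2 * s))%R by ring.
lra.
Qed.

Lemma radial_cone_le x (rho c b : R) : (0 < rho)%R -> (enorm x <= rho)%R ->
  (0 <= c)%R -> (2 * c ^+ 2 <= 1)%R ->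
  mu (cone x (c * rho) `&` ball0 b) <=
    (Num.sqrt (1 - c ^+ 2) ^+ d)%:E * mu (ball0 b).
Proof.
move=> rho0 xrho c0 c1; apply: radial_compare.
- by rewrite exprn_ge0// sqrtr_ge0.
- by apply: measurableI; [exact: measurable_cone|exact: measurable_ball0].
- exact: measurable_ball0.
move=> s s0; rewrite -setIA ball0I; set t := Num.min b s.
(* A negative [b] makes [t] negative and the ball empty. *)
have [t0|t0] := leP 0%R t; last first.
  rewrite (_ : ball0 t = set0) ?setI0 ?measure0 ?mule0//.
  by apply/seteqP; split => y //=; rewrite /ball0/= leNgt (lt_le_trans t0)// enorm_ge0.
rewrite -lebesgue_ball0_scale; last by rewrite sqrtr_gt0; lra.
rewrite -(lebesgue_eball (scale (c * t / rho) x)).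
apply: le_measure; rewrite ?inE.
- by apply: measurableI; [exact: measurable_cone|exact: measurable_ball0].
- exact: measurable_eball.
- exact: cone_ball0_subset.
Qed.

Lemma radial_opp_le A : measurable A -> mu (scale (-1) @^-1` A) <= mu A.
Proof.
move=> mA; have mA' : measurable (scale (-1) @^-1` A).
  have mS : measurable_fun setT (@scale R d (-1)).
    apply/measurable_fun_tnthP => i.
    rewrite (_ : _ \o _ = fun x => -1 * tnth x i)%R; last first.
      by apply/funext => x /=; rewrite tnth_mktuple.
    by apply: measurable_funM => //; exact: measurable_tnth.
  by rewrite -[X in measurable X]setTI; exact: mS.
rewrite -[leRHS]mul1e; apply: radial_compare => // s s0.
rewrite mul1e -[leRHS]lebesgue_opp//; last by apply: measurableI => //; exact: measurable_ball0.
rewrite preimage_setI (_ : scale (-1) @^-1` ball0 s = ball0 s)//.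
have E y : enorm (scale (-1) y) = enorm y.
  apply/eqP; rewrite -(@eqrXn2 _ 2) ?enorm_ge0//.
  by rewrite enorm_scale_sqr sqrrN expr1n mul1r.
by apply/seteqP; rewrite /ball0; split => y /=; rewrite E.
Qed.

(** A nonincreasing density makes mass grow no faster than volume. *)
Lemma radial_ball0_growth r s : (0 < r)%R -> (r <= s)%R ->
  mu (ball0 s) <= ((s / r) ^+ d)%:E * mu (ball0 r).
Proof.
move=> r0 rs; have s0 : (0 < s)%R by exact: lt_le_trans rs.
have sr1 : (1 <= s / r)%R by rewrite ler_pdivlMr// mul1r.
apply: radial_compare.
- by rewrite exprn_ge0// divr_ge0// ltW.
- exact: measurable_ball0.
- exact: measurable_ball0.
move=> t t0; rewrite !ball0I; have [tr|rt] := leP t r.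
  rewrite !min_r//; last exact: le_trans rs.
  by rewrite lee_pemull// lee_fin exprn_ege1.
rewrite -lebesgue_ball0_scale ?divr_gt0// divfK ?gt_eqF//.
apply: le_measure; rewrite ?inE; try exact: measurable_ball0.
by apply: ball0_subset; rewrite ge_min lexx.
Qed.

Lemma radial_ball0_le s : (0 < s)%R ->
  mu (ball0 s) <= (f 0 * s ^+ d)%:E * lebesgue R d (ball0 1).
Proof.
move=> s0; rewrite EFinM -muleA -lebesgue_ball0_scale// mulr1.
rewrite -integral_cst//; last exact: measurable_ball0.
apply: ge0_le_integral => //.
- exact: measurable_ball0.
- by move=> y _; rewrite lee_fin f_ge0 ?enorm_ge0.
- by apply: measurable_funTS; exact: measurable_radial.
- by move=> y _; rewrite lee_fin f_noninc ?enorm_ge0.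
Qed.

End radial_estimates.

(** * Testing the weak type inequality on a small ball *)

Section weak_type_radial.
Context {R : realType} {d : nat} {f : R -> R}.
Hypothesis f_ge0 : forall s : R, 0 <= s -> 0 <= f s.
Hypothesis f_noninc : forall s t : R, 0 <= s -> s <= t -> f t <= f s.
Local Open Scope ereal_scope.

Let mu := radial_measure d f_ge0 f_noninc.

(* Test the inequality on the indicator of a small ball around the origin: the
   ball [eball x (enorm x + e)] contains all of its mass. *)
Lemma weak_type11_ball0 (c rho e K : R) : mu setT < +oo ->
  weak_type11 mu c -> (0 <= rho)%R -> (0 < e)%R -> 0 < mu (ball0 e) ->
  (forall x, (enorm x <= rho)%R -> mu (eball x (enorm x + e)%R) <= K%:E) ->
  mu (ball0 rho) <= (c * K)%:E.
Proof.
move=> mufin wc rho0 e0 V0 HK.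
have mfin A : measurable A -> mu A \is a fin_num.
  move=> mA; rewrite ge0_fin_numE ?measure_ge0//.
  by apply: le_lt_trans mufin; exact: radial_le.
have mB := @measurable_ball0 R d.
have sub x : ball0 e `<=` eball x (enorm x + e)%R.
  move=> y; rewrite /ball0/= => ye; have y0 := enorm_ge0 y; have x0 := enorm_ge0 x.
  rewrite /eball/= le_edist ?addr_ge0 ?(ltW e0)//.
  (* The triangle inequality, squared, via Cauchy-Schwarz. *)
  by move: (dot_le x y); rewrite ler_norml => /andP[h _]; nra.
pose v := fine (mu (ball0 e)).
have vE : mu (ball0 e) = v%:E by rewrite fineK// mfin.
have v0 : (0 < v)%R by rewrite -lte_fin -vE.
have K0 : (0 < K)%R.
  rewrite -lte_fin; apply: lt_le_trans V0 _; apply: le_trans (HK [tuple 0%R | i < d] _).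
    exact/radial_le/sub.
  apply: le_trans rho0; rewrite /enorm big1 ?sqrtr0// => i _.
  by rewrite tnth_mktuple expr0n.
pose g : euclidean R d -> R := \1_(ball0 e).
have gE A : measurable A -> \int[mu]_(y in A) `|(g y)%:E| = mu (ball0 e `&` A).
  move=> mA; transitivity (\int[mu]_(y in A) (g y)%:E).
    by apply: eq_integral => y _; rewrite gee0_abs// lee_fin.
  exact: integral_indic.
have ig : mu.-integrable setT (EFin \o g).
  apply/integrableP; split; first by apply/measurable_EFinP; exact: measurable_indic.
  by rewrite gE// setIT vE ltry.
have vK0 : (0 < v / K)%R by rewrite divr_gt0.
(* On [ball0 rho] the maximal function of [g] is at least [v / K]: the ball of radius [enorm x + e]
   holds the whole mass [v] of [g] and has measure at most [K]. *)
have := wc g ig (v / K)%R vK0; rewrite gE// setIT vE => H.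
have {H} : (v / K)%:E * mu (ball0 rho) <= c%:E * v%:E.
  apply: le_trans H; apply: lee_wpmul2l; first by rewrite lee_fin ltW.
  apply: radial_le => x; rewrite /ball0/= => xrho.
  have Ve : 0 < mu (eball x (enorm x + e)%R).
    by apply: lt_le_trans V0 _; exact/radial_le/sub.
  apply: le_trans; last first.
    apply: ereal_sup_ubound; exists (enorm x + e)%R; last by reflexivity.
    by split => //; rewrite ltr_wpDl ?enorm_ge0.
  have mE := measurable_eball x (enorm x + e)%R.
  rewrite gE// setIidl// vE.
  pose m := fine (mu (eball x (enorm x + e)%R)).
  have mm : mu (eball x (enorm x + e)%R) = m%:E by rewrite fineK// mfin.
  have mK : (m <= K)%R by rewrite -lee_fin -mm; exact: HK.
  have m0 : (0 < m)%R by rewrite -lte_fin -mm.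
  rewrite [X in _ <= X^-1 * _](_ : _ = m%:E)//.
  rewrite inver gt_eqF// -EFinM lee_fin mulrC.
  by rewrite ler_wpM2r ?(ltW v0)// lef_pV2.
have := mfin _ (mB rho); case: (mu (ball0 rho)) => [w| |]// _.
rewrite -!EFinM !lee_fin mulrAC ler_pdivrMr// => h.
by rewrite -(ler_pM2l v0) (_ : v * (c * K) = c * v * K)%R//; ring.
Qed.

Lemma radial_ball0_approx (a : R) : a%:E < mu setT ->
  exists2 rho : R, (0 < rho)%R & a%:E < mu (ball0 rho).
Proof.
move=> aT.
have cv : mu (ball0 n.+1%:R) @[n --> \oo] --> mu setT.
  have -> : setT = \bigcup_n ball0 n.+1%:R :> set (euclidean R d).
    apply/seteqP; split => // y _; exists (Num.truncn (enorm y)) => //.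
    by rewrite /ball0/= ltW// truncnS_gt.
  apply: (@nondecreasing_cvg_mu _ _ _ mu (fun n => ball0 n.+1%:R)).
  - by move=> n; exact: measurable_ball0.
  - by apply: bigcup_measurable => n _; exact: measurable_ball0.
  - by move=> m n mn; apply/subsetPset; apply: ball0_subset; rewrite ler_nat.
apply: contrapT => H; move: aT; apply/negP; rewrite -leNgt -(cvg_lim _ cv)//.
apply: lime_le; first by apply/cvg_ex; eexists; exact: cv.
apply: nearW => n; rewrite leNgt; apply/negP => an; apply: H.
by exists n.+1%:R.
Qed.

(** Were a ball around the origin null, the growth bound would make all larger ones null. *)
Lemma radial_ball0_gt0 (e : R) : (0 < e)%R -> 0 < mu setT -> 0 < mu (ball0 e).
Proof.
move=> e0 /radial_ball0_approx[rho rho0 Vrho].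
have [re|er] := leP rho e.
  by apply: lt_le_trans Vrho _; apply: radial_le; exact: ball0_subset.
rewrite lt_neqAle measure_ge0 andbT; apply/eqP => V0.
have := @radial_ball0_growth R d f f_ge0 f_noninc e rho e0 (ltW er).
by rewrite -/mu -V0 mule0 leNgt Vrho.
Qed.

End weak_type_radial.

(** * The dimension-free bound by 2 *)

Section two_le_constant.
Context {R : realType} {d : nat} {f : R -> R}.
Hypothesis f_ge0 : forall s : R, 0 <= s -> 0 <= f s.
Hypothesis f_noninc : forall s t : R, 0 <= s -> s <= t -> f t <= f s.
Local Open Scope ereal_scope.

Let mu := radial_measure d f_ge0 f_noninc.

Lemma radial_ball0_small (a : R) : (0 < d)%N -> (0 < a)%R ->
  exists2 s : R, (0 < s)%R & mu (ball0 s) <= a%:E.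
Proof.
move=> d0 a0; pose L := fine (lebesgue R d (ball0 1)).
have LE : lebesgue R d (ball0 1) = L%:E.
  by rewrite fineK// ge0_fin_numE ?lebesgue_ball0_fin.
have L0 : (0 <= L)%R by rewrite fine_ge0.
have f00 : (0 <= f 0)%R by rewrite f_ge0.
have k0 : (0 < f 0 * L + 1)%R by rewrite ltr_wpDl ?mulr_ge0.
(* Being at most 1 gives [s ^+ d <= s], since [d] is positive; the added 1 keeps the denominator
   nonzero. *)
pose s := Num.min 1%R (a / (f 0 * L + 1))%R.
have s0 : (0 < s)%R by rewrite lt_min ltr01 divr_gt0.
exists s => //; apply: le_trans (radial_ball0_le f_ge0 f_noninc s0) _.
rewrite LE -EFinM lee_fin.
have ss : (s ^+ d <= s)%R.
  by rewrite -[leRHS]expr1 ler_wiXn2l ?(ltW s0)// /s ge_min lexx.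
have sa : (s * (f 0 * L + 1) <= a)%R.
  by rewrite -ler_pdivlMr// /s ge_min lexx orbT.
rewrite mulrAC; apply: le_trans sa; rewrite mulrC ler_pM ?exprn_ge0 ?mulr_ge0 ?(ltW s0)//.
by rewrite lerDl.
Qed.

(* [eball x r] and its mirror image only overlap near the origin. *)
Lemma radial_ball_half x (rho e eta : R) : (0 <= e)%R -> (0 <= eta)%R ->
  (enorm x <= rho)%R -> (2 * e * rho + e ^+ 2 <= eta ^+ 2)%R ->
  2%:E * mu (eball x (enorm x + e)%R) <= mu setT + mu (ball0 eta).
Proof.
move=> e0 eta0 xrho he; set r := (enorm x + e)%R; have x0 := enorm_ge0 x.
have r0 : (0 <= r)%R by rewrite addr_ge0.
have nx z : enorm (scale (-1) z : euclidean R d) = enorm z.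
  apply/eqP; rewrite -(@eqrXn2 _ 2) ?enorm_ge0//.
  by rewrite enorm_scale_sqr sqrrN expr1n mul1r.
have mE z := @measurable_eball R d z r.
have mB := @measurable_ball0 R d eta.
have opp : mu (eball x r) <= mu (eball (scale (-1) x) r).
  apply: le_trans (radial_opp_le f_ge0 f_noninc (mE (scale (-1) x))).
  apply: radial_le => y; rewrite /eball/= !le_edist// !nx.
  rewrite dot_scaler dot_scalel (_ : -1 * (-1 * dot x y) = dot x y)%R//.
  by ring.
rewrite mule_natl mule2n.
apply: (@le_trans _ _ (mu (eball x r) + (mu (eball (scale (-1) x) r `\` ball0 eta) + mu (ball0 eta)))).
  rewrite leeD2l// (le_trans opp)//.
  apply: le_trans (measureU2 _ _ _) => //; last exact: measurableD.
  by apply: radial_le => y yx; rewrite /=; case: (pselect (ball0 eta y)); [right|left].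
rewrite addeA leeD2r// -measureU//.
- exact: radial_le.
- exact: measurableD.
- apply/seteqP; split => // y [] /=; rewrite /eball/ball0/= !le_edist// nx dot_scalel.
  move=> h1 [h2 /negP]; rewrite -ltNge => h3.
  (* Adding the two ball conditions cancels [dot x y] and leaves
     [enorm y ^+ 2 <= 2 * e * enorm x + e ^+ 2], which is at most [eta ^+ 2]. *)
  have : (eta ^+ 2 < enorm y ^+ 2)%R by rewrite ltr_sqr ?nnegrE ?enorm_ge0.
  move: h1 h2; rewrite /r; nra.
Qed.

(** The test inequality with [K] half of [mu setT + mu (ball0 eta)] gives [key]; as [rho] grows and
    [eta] shrinks, [key] tends to [2 * M <= c * M]. *)
Lemma two_le_weak_type11 (c : R) : (0 < d)%N -> 0 < mu setT -> mu setT < +oo ->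
  weak_type11 mu c -> (2 <= c)%R.
Proof.
move=> d0 mu0 mufin wc.
pose M := fine (mu setT).
have ME : mu setT = M%:E by rewrite fineK// ge0_fin_numE.
have M0 : (0 < M)%R by rewrite -lte_fin -ME.
have key rho eta : (0 < rho)%R -> (0 < eta)%R ->
    2%:E * mu (ball0 rho) <= c%:E * (mu setT + mu (ball0 eta)).
  move=> rho0 eta0; pose e := Num.min 1%R (eta ^+ 2 / (2 * rho + 1))%R.
  have k0 : (0 < 2 * rho + 1)%R by lra.
  have e0 : (0 < e)%R by rewrite lt_min ltr01 divr_gt0// exprn_gt0.
  have e1 : (e <= 1)%R by rewrite ge_min lexx.
  have e2 : (e * (2 * rho + 1) <= eta ^+ 2)%R.
    by rewrite -ler_pdivlMr// ge_min lexx orbT.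
  have he : (2 * e * rho + e ^+ 2 <= eta ^+ 2)%R by nra.
  have Vfin : mu (ball0 eta) \is a fin_num.
    rewrite ge0_fin_numE ?measure_ge0//; apply: le_lt_trans mufin; exact: radial_le.
  pose v := fine (mu (ball0 eta)); have vE : mu (ball0 eta) = v%:E by rewrite fineK.
  have := @weak_type11_ball0 R d f f_ge0 f_noninc c rho e ((M + v) / 2)
    mufin wc (ltW rho0) e0 (radial_ball0_gt0 e0 mu0).
  rewrite -/mu ME vE -EFinD => H.
  have {}H : mu (ball0 rho) <= (c * ((M + v) / 2))%:E.
    apply: H => x xrho.
    have := radial_ball_half (ltW e0) (ltW eta0) xrho he.
    rewrite -/mu ME vE -EFinD.
    have : mu (eball x (enorm x + e)%R) \is a fin_num.
      rewrite ge0_fin_numE ?measure_ge0//; apply: le_lt_trans mufin; exact: radial_le.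
    by case: (mu (eball _ _)) => [m| |]//= _; rewrite -EFinM !lee_fin; lra.
  have := H; have : mu (ball0 rho) \is a fin_num.
    rewrite ge0_fin_numE ?measure_ge0//; apply: le_lt_trans mufin; exact: radial_le.
  case: (mu (ball0 rho)) => [m| |]//= _; rewrite -!EFinM !lee_fin; lra.
rewrite leNgt; apply/negP => c2.
have [c0|c0] := leP c 0%R.
  have := key 1%R 1%R ltr01 ltr01; apply/negP; rewrite -ltNge.
  apply: (@le_lt_trans _ _ 0).
    by rewrite mule_le0_ge0 ?lee_fin// adde_ge0 ?measure_ge0.
  by rewrite mule_gt0// radial_ball0_gt0.
(* With this choice [2 * (1 - del) - c * (1 + del)] equals [(2 - c) * (6 - c) / 8], which is
   positive and contradicts [key]. *)
pose del := ((2 - c) / 8)%R.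
have del0 : (0 < del)%R by rewrite divr_gt0 ?subr_gt0.
have [|rho rho0 Vrho] := @radial_ball0_approx R d f f_ge0 f_noninc ((1 - del) * M).
  by rewrite -/mu ME lte_fin -[ltRHS]mul1r ltr_pM2r// ltrBlDr ltrDl.
have [eta eta0 Veta] := @radial_ball0_small (del * M) d0 (mulr_gt0 del0 M0).
have := key rho eta rho0 eta0; apply/negP; rewrite -ltNge.
apply: (@le_lt_trans _ _ (c%:E * (M%:E + (del * M)%:E))).
  by rewrite lee_wpmul2l ?lee_fin ?(ltW c0)// ME leeD2l.
apply: (@lt_le_trans _ _ (2%:E * ((1 - del) * M)%:E)); last first.
  by rewrite lee_wpmul2l ?lee_fin// ltW.
rewrite -EFinD -!EFinM lte_fin -subr_gt0.
rewrite (_ : _ - _ = M * ((2 - c) * (6 - c)) / 8)%R; last by rewrite /del; field.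
by rewrite divr_gt0// mulr_gt0// mulr_gt0// subr_gt0// (lt_trans c2)// ltr_nat.
Qed.

End two_le_constant.

(** * Covering a ball that barely contains the origin, and almost maximal growth *)

Section tangent_balls.
Context {R : realType} {d : nat} {f : R -> R}.
Hypothesis f_ge0 : forall s : R, 0 <= s -> 0 <= f s.
Hypothesis f_noninc : forall s t : R, 0 <= s -> s <= t -> f t <= f s.
Implicit Types (x : euclidean R d) (rho e t : R).

Let mu := radial_measure d f_ge0 f_noninc.

(** The parameter [t] absorbs the excess [e] of the radius. At [t = 0] a point at distance [s] from
    the origin satisfies [s ^+ 2 <= 2 * dot x y], so it lies in the cone of cosine [s / (2 * rho)].
    This reaches [1 / sqrt 2], the largest cosine the cone estimate allows, at [s = sqrt 2 * rho];
    hence the second cut. *)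
Lemma tangent_ball_subset x rho e t : 0 < rho -> 0 <= e -> 0 <= t -> t <= 1 ->
  enorm x <= rho -> 2 * e * rho + e ^+ 2 <= t * rho ^+ 2 ->
  eball x (enorm x + e) `<=`
    eball (scale 2^-1 x) (Num.sqrt (3 / 4 * (1 + t)) * rho) `|`
    (cone x ((1 - t) / 2 * rho) `&` ball0 (Num.sqrt 2 * rho)) `|`
    (cone x ((1 - t / 2) / Num.sqrt 2 * rho) `&` ball0 (2 * (1 + t) * rho)).
Proof.
move=> rho0 e0 t0 t1 xrho he y.
have x0 := enorm_ge0 x; have s0 := enorm_ge0 y.
rewrite {1}/eball/= le_edist ?addr_ge0// => yx.
have {yx} : enorm y ^+ 2 <= 2 * dot x y + t * rho ^+ 2.
  apply: le_trans (lerD (lexx _) he); rewrite -subr_ge0.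
  have : 0 <= 2 * e * (rho - enorm x) by rewrite !mulr_ge0 ?subr_ge0.
  lra.
have := dot_le x y; rewrite ler_norml => /andP[_].
have : enorm x ^+ 2 <= rho ^+ 2 by rewrite ler_sqr ?nnegrE// ltW.
have : enorm x * enorm y <= rho * enorm y by rewrite ler_wpM2r.
move: s0; set s := enorm y => s0 h1 h2 h3 h4.
have w0 : 0 <= Num.sqrt (2 : R) by exact: sqrtr_ge0.
have w2 : Num.sqrt (2 : R) ^+ 2 = 2 by rewrite sqr_sqrtr.
have w1 : 1 <= Num.sqrt (2 : R) by rewrite -ler_sqr ?nnegrE// w2 expr1n ler1n.
move: (Num.sqrt 2) w0 w2 w1 => w w0 w2 w1.
have [srho|rhos] := leP s rho.
  left; left; rewrite /eball/= le_edist; last by rewrite mulr_ge0 ?sqrtr_ge0 ?ltW.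
  rewrite exprMn [X in _ <= X * _]sqr_sqrtr; last by rewrite mulr_ge0// addr_ge0.
  rewrite enorm_scale_sqr dot_scalel -/s.
  have : s ^+ 2 <= rho ^+ 2 by rewrite ler_sqr ?nnegrE// ltW.
  have : 0 <= t * rho ^+ 2 by rewrite mulr_ge0// sqr_ge0.
  lra.
have [swrho|wrhos] := leP s (w * rho).
  left; right; split => //; rewrite /cone/= -/s.
  have : 0 <= (s - rho) * (s + t * rho).
    by rewrite mulr_ge0 ?subr_ge0 ?(ltW rhos)// addr_ge0// mulr_ge0// ltW.
  lra.
right; split; rewrite /cone/ball0/= -/s.
  have wE : w^-1 = w / 2 by rewrite -w2 invfM mulrA divff ?mul1r// gt_eqF// (lt_le_trans ltr01).
  rewrite wE.
  have a1 : 0 <= s * (s - w * rho) by rewrite mulr_ge0// subr_ge0 ltW.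
  have : 0 <= t * rho * (w * (s - w * rho)).
    by rewrite !mulr_ge0 ?subr_ge0 ?(ltW wrhos)// ltW.
  rewrite (_ : t * rho * (w * (s - w * rho)) = t * rho * (w * s) - t * rho * rho * w ^+ 2).
    by rewrite w2; lra.
  by ring.
rewrite leNgt; apply/negP => hs.
(* Expanded, this contradicts [s ^+ 2 <= 2 * rho * s + t * rho ^+ 2]. *)
have : 0 < (s - 2 * (1 + t) * rho) * (s + 2 * t * rho).
  rewrite mulr_gt0 ?subr_gt0// ltr_pwDl ?mulr_ge0 ?(ltW rho0)//.
  by rewrite (lt_trans _ rhos).
have : 0 <= t * rho * rho by rewrite !mulr_ge0 ?(ltW rho0).
have : 0 <= t * t * rho * rho by rewrite !mulr_ge0 ?(ltW rho0).
lra.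
Qed.

Lemma radial_tangent_ball_le x rho e t : 0 < rho -> 0 <= e -> 0 <= t -> t <= 1 ->
  enorm x <= rho -> 2 * e * rho + e ^+ 2 <= t * rho ^+ 2 ->
  (mu (eball x (enorm x + e)%R) <=
    mu (ball0 (Num.sqrt (3 / 4 * (1 + t)) * rho)%R) +
    (Num.sqrt (3 / 4 * (1 + t)) ^+ d)%:E * mu (ball0 (Num.sqrt 2 * rho)%R) +
    (Num.sqrt (2^-1 * (1 + t)) ^+ d)%:E * mu (ball0 (2 * (1 + t) * rho)%R))%E.
Proof.
move=> rho0 e0 t0 t1 xrho he.
apply: le_trans (radial_le f_ge0 f_noninc (tangent_ball_subset rho0 e0 t0 t1 xrho he)) _.
have mE := @measurable_eball R d; have mB := @measurable_ball0 R d.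
have mC := @measurable_cone R d.
(* Rounds [1 - c ^+ 2] up to [3 / 4 * (1 + t)] for the middle cone and to [2^-1 * (1 + t)] for the
   outer one. *)
have cone_le c b q : 0 <= c -> 2 * c ^+ 2 <= 1 -> 1 - c ^+ 2 <= q ->
    (mu (cone x (c * rho) `&` ball0 b) <= (Num.sqrt q ^+ d)%:E * mu (ball0 b))%E.
  move=> c0 c1 cq; apply: le_trans (radial_cone_le f_ge0 f_noninc _ rho0 xrho c0 c1) _.
  rewrite lee_wpmul2r ?measure_ge0// lee_fin lerXn2r ?nnegrE ?sqrtr_ge0//.
  exact: ler_wsqrtr.
apply: le_trans (measureU2 _ _ _) _.
- by apply: measurableU; [exact: mE|exact: measurableI].
- exact: measurableI.
apply: leeD.
  apply: le_trans (measureU2 _ _ _) _; [exact: mE|exact: measurableI|].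
  apply: leeD; first exact: radial_eball_le.
  by apply: cone_le; nra.
have w2 : Num.sqrt (2 : R) ^+ 2 = 2 by rewrite sqr_sqrtr.
have w0 : 0 < Num.sqrt (2 : R) by rewrite sqrtr_gt0.
have cE : ((1 - t / 2) / Num.sqrt 2) ^+ 2 = (1 - t / 2) ^+ 2 / 2.
  by rewrite expr_div_n w2.
apply: cone_le; first by rewrite divr_ge0 ?(ltW w0)//; lra.
  by rewrite cE; nra.
by rewrite cE; nra.
Qed.

End tangent_balls.

(* [V s / s `^ p] is bounded, so it is almost maximal at some [rho]. *)
Lemma exists_powR_growth (R : realType) (V : R -> R) (C p a : R) : 1 < a ->
  (forall s, 0 < s -> 0 <= V s) -> (forall s, 0 < s -> V s <= C * s `^ p) -> 0 < V 1 ->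
  exists2 rho, 0 < rho & forall s, 0 < s -> V (s * rho) <= a * s `^ p * V rho.
Proof.
move=> a1 V0 VC V1.
pose S := [set V s / s `^ p | s in [set s | 0 < s]].
have S1 : S (V 1) by exists 1 => //=; rewrite powR1 divr1.
have ubS : ubound S C.
  by move=> _ [s /= s0 <-]; rewrite ler_pdivrMr ?powR_gt0// VC.
have supS : has_sup S by split; [exists (V 1)|exists C].
have sup0 : 0 < sup S by apply: lt_le_trans V1 _; apply: ub_le_sup => //; exists C.
have a0 : 0 < a by lra.
(* The ratio at this [rho] exceeds [sup S / a], which produces the factor [a]. *)
have [|_ [rho /= rho0 <-]] := @sup_adherent _ S (sup S - sup S / a) _ supS.
  by rewrite subr_gt0 ltr_pdivrMr// ltr_pMr.
rewrite subKr => hrho; exists rho => // s s0.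
have sr0 : 0 < s * rho by exact: mulr_gt0.
have : V (s * rho) / (s * rho) `^ p <= sup S.
  by apply: ub_le_sup; [exists C|exists (s * rho)].
rewrite ler_pdivrMr ?powR_gt0// => /le_trans; apply.
move: hrho; rewrite ltr_pdivrMr// => /ltW hrho.
rewrite powRM ?(ltW s0) ?(ltW rho0)// mulrCA (mulrC a) -mulrA ler_wpM2l ?powR_ge0//.
by rewrite -ler_pdivlMr ?powR_gt0// -mulrA mulrC.
Qed.

(** * Numerical inequalities *)

Section numerics.
Context {R : realType}.
Implicit Types (x a b u D : R) (d n m k : nat).

Lemma powR_root x n m D : 0 <= x -> x `^ (n%:R * D / m%:R) = (x ^+ n) `^ (D / m%:R).
Proof. by move=> x0; rewrite -mulrA powRrM powR_mulrn. Qed.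

(** Reduces a bound on a real power to a comparison of natural powers of rationals at the smallest
    exponent [n]. *)
Lemma powR_root_le b u n m D : (0 < m)%N -> 0 < b -> b <= 1 -> 0 <= u ->
  b ^+ n <= u ^+ m -> n%:R <= D -> b `^ (D / m%:R) <= u.
Proof.
move=> m0 b0 b1 u0 bu nD; have m1 : 0 < m%:R :> R by rewrite ltr0n.
apply: (@le_trans _ _ (b `^ (n%:R / m%:R))).
  by apply: ger_powR; rewrite ?b0// ler_pM2r ?invr_gt0.
rewrite powRrM powR_mulrn ?(ltW b0)//.
apply: (@le_trans _ _ ((u ^+ m) `^ m%:R^-1)).
  by rewrite ge0_ler_powR ?nnegrE ?invr_ge0 ?exprn_ge0 ?(ltW b0)// ltW.
by rewrite -powR_mulrn// -powRrM divff ?gt_eqF// powRr1.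
Qed.

Lemma sqrtr_expn x d : 0 <= x -> Num.sqrt x ^+ d = x `^ (d%:R / 2).
Proof.
by move=> x0; rewrite -powR_mulrn ?sqrtr_ge0// -powR12_sqrt// -powRrM mulrC.
Qed.

Lemma sum_powR_le D : 35%:R <= D ->
  (3 / 4) `^ (D / 8) + (3 / 4) `^ (D / 2) * 2 `^ (D / 8) +
    2^-1 `^ (D / 2) * 2 `^ (D / 4) <= 299 / 300 * (3 / 4) `^ (D / 12).
Proof.
move=> D35.
have E k n x : 0 <= x -> (k * n = 24)%N -> x `^ (D / n%:R) = (x ^+ k) `^ (D / 24).
  move=> x0 kn; rewrite -powR_root//; congr (_ `^ _).
  have k0 : k%:R != 0 :> R by rewrite pnatr_eq0; case: k kn.
  have n0 : n%:R != 0 :> R by rewrite pnatr_eq0; case: n kn => //; rewrite muln0.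
  by rewrite -[24]/(24%:R) -kn natrM; field; rewrite n0.
rewrite (E 3%N 8%N (3 / 4)) ?(E 3%N 8%N 2) ?(E 12%N 2%N) ?(E 6%N 4%N) ?(E 2%N 12%N)//; try lra.
have -> : (3 / 4 : R) ^+ 3 = 3 / 4 * (3 / 4) ^+ 2 by field.
rewrite -!powRM ?exprn_ge0 ?mulr_ge0//; try lra.
rewrite (_ : (3 / 4) ^+ 12 * 2 ^+ 3 = (3 ^+ 10 / 2 ^+ 17) * (3 / 4) ^+ 2); last by field.
rewrite (_ : 2^-1 ^+ 12 * 2 ^+ 6 = 36^-1 * (3 / 4) ^+ 2); last by field.
rewrite !(powRM _ _ (y := (3 / 4) ^+ 2)) ?exprn_ge0 ?divr_ge0 ?invr_ge0 ?exprn_ge0//; try lra.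
rewrite -!mulrDl ler_wpM2r ?powR_ge0//.
have h1 : (3 / 4) `^ (D / 24) <= 2 / 3.
  by apply: (@powR_root_le _ _ 35) => //; lra.
have h2 : (3 ^+ 10 / 2 ^+ 17) `^ (D / 24) <= 8 / 25.
  by apply: (@powR_root_le _ _ 35) => //; lra.
have h3 : (36^-1) `^ (D / 24) <= 1 / 100.
  by apply: (@powR_root_le _ _ 35) => //; lra.
lra.
Qed.

(** A Bernoulli-type bound: [(1 + x) ^+ d * (1 - x * d%:R) <= 1] by induction. *)
Lemma exprn1D_le x d : 0 <= x -> x * d%:R < 1 ->
  (1 + x) ^+ d <= (1 - x * d%:R)^-1.
Proof.
move=> x0 xd; rewrite -[leRHS]mul1r ler_pdivlMr ?subr_gt0//.
elim: d xd => [|d IH] xd; first by rewrite expr0 mulr0 subr0 mulr1.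
have xd' : x * d%:R < 1 by apply: le_lt_trans xd; rewrite ler_wpM2l// ler_nat.
apply: le_trans (IH xd'); rewrite exprS mulrC mulrA mulrC ler_wpM2l ?exprn_ge0 ?addr_ge0//.
rewrite -natr1.
have : 0 <= x * x * d%:R by rewrite !mulr_ge0.
have : 0 <= x * x by rewrite mulr_ge0.
lra.
Qed.

Lemma exists_exprn1D_le a d : 1 < a -> exists t, [/\ 0 < t, t <= 1 & (1 + t) ^+ d <= a].
Proof.
move=> a1; have a0 : 0 < a by exact: lt_trans a1.
have ai : a^-1 < 1 by rewrite invf_lt1.
have ai0 : 0 < a^-1 by rewrite invr_gt0.
have d1 : 1 <= d.+1%:R :> R by rewrite ler1n.
pose t := (1 - a^-1) / d.+1%:R; exists t.
have t0 : 0 < t by rewrite divr_gt0 ?subr_gt0.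
have td : t * d%:R <= 1 - a^-1.
  by rewrite -[leRHS](divfK (_ : d.+1%:R != 0)) ?pnatr_eq0// ler_wpM2l ?(ltW t0)// ler_nat.
split => //.
  by rewrite ler_pdivrMr// mul1r (le_trans _ d1)// gerBl ltW.
apply: le_trans (exprn1D_le (ltW t0) _) _; first lra.
by rewrite -[leRHS]invrK lef_pV2 ?posrE//; lra.
Qed.

(** The power is at most 2.28, its exponent being at most [34 / 12 = 17 / 6], and the inverted
    factor is at least 1.14. *)
Lemma small_d_bound d : (1 <= d)%N -> (d <= 34)%N ->
  (1 + 2 * Num.sqrt 2 / Num.sqrt (3 * pi * d%:R) * Num.sqrt (1 + d%:R^-1))^-1
     * (4 / 3) `^ (d%:R / 12) <= 2 :> R.
Proof.
move=> d1 d34; have d0 : 0 < d%:R :> R by rewrite ltr0n.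
have d34R : d%:R <= 34 :> R by rewrite (ler_nat _ d 34).
have pi4 : pi <= 4 :> R by have := @pihalf_lt2 R; lra.
have pi0 := @pi_gt0 R.
have hB : (4 / 3) `^ (d%:R / 12) <= 228 / 100 :> R.
  apply: (@le_trans _ _ ((4 / 3) `^ (17%:R * 1 / 6%:R))).
    by apply: ler_powR; lra.
  rewrite powR_root; last by lra.
  apply: (@le_trans _ _ (((228 / 100) ^+ 6) `^ (1 / 6%:R))).
    by rewrite ge0_ler_powR ?nnegrE//; lra.
  by rewrite -powR_root ?mulr1 ?divff ?powRr1//; lra.
have hE : 14 / 100 <= 2 * Num.sqrt 2 / Num.sqrt (3 * pi * d%:R) :> R.
  rewrite ler_pdivlMr ?sqrtr_gt0 ?mulr_gt0//.
  rewrite -ler_sqr ?nnegrE ?mulr_ge0 ?sqrtr_ge0//; try lra.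
  rewrite !exprMn !sqr_sqrtr ?mulr_ge0//; try lra.
  have : pi * d%:R <= 4 * 34 :> R by apply: ler_pM => //; lra.
  lra.
have hS : 1 <= Num.sqrt (1 + d%:R^-1) :> R.
  by rewrite -[leLHS]sqrtr1 ler_wsqrtr// lerDl invr_ge0 ltW.
have hES : 14 / 100 <= 2 * Num.sqrt 2 / Num.sqrt (3 * pi * d%:R) * Num.sqrt (1 + d%:R^-1) :> R.
  by rewrite -[leLHS]mulr1 ler_pM//; lra.
rewrite mulrC ler_pdivrMr; lra.
Qed.

End numerics.

(** * The exponential bound in large dimension *)

Section exponential_bound.
Context {R : realType} {d : nat} {f : R -> R}.
Hypothesis f_ge0 : forall s : R, 0 <= s -> 0 <= f s.
Hypothesis f_noninc : forall s t : R, 0 <= s -> s <= t -> f t <= f s.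

Let mu := radial_measure d f_ge0 f_noninc.
Let V (s : R) : R := fine (mu (ball0 s)).

Hypothesis mu_fin : (mu setT < +oo)%E.

Let VE s : mu (ball0 s) = (V s)%:E.
Proof.
rewrite fineK// ge0_fin_numE ?measure_ge0//; apply: le_lt_trans mu_fin; exact: radial_le.
Qed.

Let V_ge0 s : 0 <= V s.
Proof. by rewrite fine_ge0// measure_ge0. Qed.

(** Bounded density controls radii up to 1, where [s ^+ d <= s]^ p[; finite total mass controls the
    others, where]1 <= s [^ p]. *)
Lemma radial_ball0_powR p : 0 <= p -> p <= d%:R ->
  exists C, forall s, 0 < s -> V s <= C * s `^ p.
Proof.
move=> p0 pd; pose L := fine (lebesgue R d (ball0 1)).
have LE : lebesgue R d (ball0 1) = L%:E.
  by rewrite fineK// ge0_fin_numE ?lebesgue_ball0_fin.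
have L0 : 0 <= L by rewrite fine_ge0.
have f00 : 0 <= f 0 by rewrite f_ge0.
have ME : mu setT = (fine (mu setT))%:E by rewrite fineK// ge0_fin_numE.
have M0 : 0 <= fine (mu setT) by rewrite fine_ge0// measure_ge0.
exists (f 0 * L + fine (mu setT)) => s s0; rewrite mulrDl.
have sp : 0 <= s `^ p by exact: powR_ge0.
have [s1|s1] := leP s 1.
  rewrite -[leLHS]addr0 lerD ?mulr_ge0//.
  have := @radial_ball0_le R d f f_ge0 f_noninc s s0.
  rewrite -/mu VE LE -EFinM lee_fin => /le_trans; apply.
  rewrite mulrAC ler_wpM2l ?mulr_ge0// -powR_mulrn ?(ltW s0)//.
  by apply: ger_powR; rewrite ?s0.
rewrite -[leLHS]add0r lerD ?mulr_ge0//.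
apply: (@le_trans _ _ (fine (mu setT))).
  by rewrite -lee_fin -VE -ME; exact: radial_le.
by rewrite ler_peMr// -(powRr0 s) ler_powR// ltW.
Qed.

Lemma weak_type11_large_dim (c : R) : (0 < mu setT)%E -> (35 <= d)%N ->
  weak_type11 mu c -> 1 <= c * (3 / 4) `^ (d%:R / 12).
Proof.
move=> mu0 d35 wc.
have D35 : 35%:R <= d%:R :> R by rewrite ler_nat.
have d0 : 0 < d%:R :> R by apply: lt_le_trans D35.
(* Supplies the sign of [c] for multiplying the bound on [K]. *)
have c2 : 2 <= c.
  exact: (two_le_weak_type11 (ltn_trans (ltn0Sn 33) d35) mu0 mu_fin wc).
(* At most three factors [a] are lost, from almost maximality and from powers of [1 + t]; the margin
   [299 / 300] pays for them. *)
have [a a1 a3] : exists2 a : R, 1 < a & a * a * a * (299 / 300) <= 1.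
  by exists (1 + 1 / 1000); lra.
have [t [t0 t1 Ta]] := exists_exprn1D_le d a1.
have Tp x q : 0 <= x -> 0 <= q -> q <= d%:R -> (x * (1 + t)) `^ q <= a * x `^ q.
  move=> x0 q0 qd; rewrite powRM ?addr_ge0 ?(ltW t0)// mulrC ler_wpM2r ?powR_ge0//.
  apply: le_trans Ta; rewrite -powR_mulrn ?addr_ge0 ?(ltW t0)//.
  by apply: ler_powR; rewrite // lerDl ltW.
have [||C VC] := @radial_ball0_powR (d%:R / 4); [lra|lra|].
have V0 s : 0 < s -> 0 < V s.
  by move=> s0; rewrite -lte_fin -VE; exact: radial_ball0_gt0.
have [||rho rho0 hrho] := @exists_powR_growth R V C (d%:R / 4) a _ _ VC (V0 1 ltr01).
- exact: a1.
- by move=> s _.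
(* Makes [2 * e * rho + e ^+ 2] equal to [t * rho ^+ 2 * (2 / 3 + t / 9)], within the allowance as
   [t <= 1]. *)
pose e := rho * t / 3.
have e0 : 0 < e by rewrite /e divr_gt0// mulr_gt0.
have he : 2 * e * rho + e ^+ 2 <= t * rho ^+ 2.
  rewrite (_ : _ + _ = t * rho ^+ 2 * (2 / 3 + t / 9)); last by rewrite /e; field.
  by rewrite ler_piMr ?mulr_ge0 ?sqr_ge0 ?(ltW t0)//; lra.
pose r1 := Num.sqrt (3 / 4 * (1 + t)); pose r2 := Num.sqrt (2^-1 * (1 + t)).
pose K := V (r1 * rho) + r1 ^+ d * V (Num.sqrt 2 * rho) + r2 ^+ d * V (2 * (1 + t) * rho).
have hK : (mu (ball0 rho) <= (c * K)%:E)%E.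
  apply: (@weak_type11_ball0 R d f f_ge0 f_noninc c rho e K mu_fin wc (ltW rho0) e0).
    exact: radial_ball0_gt0.
  move=> x xrho; apply: le_trans
    (radial_tangent_ball_le f_ge0 f_noninc rho0 (ltW e0) (ltW t0) t1 xrho he) _.
  by rewrite -/mu !VE -!EFinM -!EFinD.
have a0 : 0 < a by exact: lt_trans a1.
have q1 : 0 <= 3 / 4 * (1 + t) :> R by lra.
have q2 : 0 <= 2^-1 * (1 + t) :> R by lra.
have sqrt_pow x : 0 <= x -> Num.sqrt x `^ (d%:R / 4) = x `^ (d%:R / 8).
  by move=> x0; rewrite -powR12_sqrt// -powRrM; congr (_ `^ _); field.
have Vr := V0 rho rho0.
have K1 : V (r1 * rho) <= a * a * (3 / 4) `^ (d%:R / 8) * V rho.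
  apply: le_trans (hrho _ _) _; first by rewrite sqrtr_gt0; lra.
  rewrite ler_wpM2r ?(ltW Vr)// -mulrA ler_wpM2l ?(ltW a0)// sqrt_pow//.
  by apply: Tp; lra.
have K2 : r1 ^+ d * V (Num.sqrt 2 * rho) <=
    a * a * ((3 / 4) `^ (d%:R / 2) * 2 `^ (d%:R / 8)) * V rho.
  rewrite sqrtr_expn//.
  have h1 : (3 / 4 * (1 + t)) `^ (d%:R / 2) <= a * (3 / 4) `^ (d%:R / 2) by apply: Tp; lra.
  have h2 : V (Num.sqrt 2 * rho) <= a * 2 `^ (d%:R / 8) * V rho.
    by apply: le_trans (hrho _ _) _; rewrite ?sqrtr_gt0// sqrt_pow.
  apply: le_trans (ler_pM _ _ h1 h2) _; rewrite ?powR_ge0//.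
  by rewrite le_eqVlt; apply/orP; left; apply/eqP; ring.
have K3 : r2 ^+ d * V (2 * (1 + t) * rho) <=
    a * a * (2^-1 `^ (d%:R / 2) * 2 `^ (d%:R / 4)) * a * V rho.
  rewrite sqrtr_expn//.
  have h1 : (2^-1 * (1 + t)) `^ (d%:R / 2) <= a * 2^-1 `^ (d%:R / 2) by apply: Tp; lra.
  have h2 : V (2 * (1 + t) * rho) <= a * (a * 2 `^ (d%:R / 4)) * V rho.
    apply: le_trans (hrho _ _) _; first lra.
    by rewrite ler_wpM2r ?(ltW Vr)// ler_wpM2l ?(ltW a0)//; apply: Tp; lra.
  apply: le_trans (ler_pM _ _ h1 h2) _; rewrite ?powR_ge0//.
  by rewrite le_eqVlt; apply/orP; left; apply/eqP; ring.
have hB := sum_powR_le D35.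
have q0 : 0 < (3 / 4) `^ (d%:R / 12) :> R by apply: powR_gt0; lra.
pose q : R := (3 / 4) `^ (d%:R / 12); pose B1 : R := (3 / 4) `^ (d%:R / 8).
pose B2 : R := (3 / 4) `^ (d%:R / 2) * 2 `^ (d%:R / 8).
pose B3 : R := 2^-1 `^ (d%:R / 2) * 2 `^ (d%:R / 4).
rewrite -/q -/B1 -/B2 -/B3 in hB K1 K2 K3 q0.
have B0 : 0 <= B1 + B2 by rewrite addr_ge0 ?mulr_ge0 ?powR_ge0.
have KV : K <= q * V rho.
  apply: (@le_trans _ _ (a * a * a * (B1 + B2 + B3) * V rho)).
    have a2 : a * a <= a * a * a by rewrite ler_peMr ?mulr_ge0 ?(ltW a0) ?(ltW a1).
    have : a * a * (B1 + B2) * V rho <= a * a * a * (B1 + B2) * V rho.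
      by rewrite ler_wpM2r ?(ltW Vr)// ler_wpM2r.
    rewrite /K; lra.
  rewrite ler_wpM2r ?(ltW Vr)//.
  apply: (@le_trans _ _ (a * a * a * (299 / 300 * q))).
    by rewrite ler_wpM2l ?mulr_ge0 ?(ltW a0).
  by rewrite mulrA ler_piMl// ltW.
move: hK; rewrite VE lee_fin => hK.
have : V rho <= c * q * V rho.
  by apply: le_trans hK _; rewrite -mulrA ler_wpM2l//; lra.
by rewrite -[leLHS]mul1r ler_pM2r.
Qed.

End exponential_bound.

(** * The lower bound in every dimension *)

Unset Implicit Arguments.

Theorem theorem2p3 (R : realType) (d : nat) (d_ge1 : (1 <= d)%N) (f : R -> R)
  (f_ge0 : forall s : R, 0 <= s -> 0 <= f s)
  (f_noninc : forall s t : R, 0 <= s -> s <= t -> f t <= f s) :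
  let mu := radial_measure d f_ge0 f_noninc in
  (0 < mu setT)%E -> (mu setT < +oo)%E ->
  (((1 + 2 * Num.sqrt 2 / Num.sqrt (3 * pi * d%:R) * Num.sqrt (1 + d%:R^-1))^-1
     * (2 / Num.sqrt 3) `^ (d%:R / 6))%:E
   <= weak_type11_constant mu)%E.
Proof.
move=> mu mu0 mu_fin; apply: le_ereal_inf_tmp => _ [c wc <-]; rewrite lee_fin.
have c2 : 2 <= c by exact: (two_le_weak_type11 d_ge1 mu0 mu_fin wc).
have -> : (2 / Num.sqrt 3) `^ (d%:R / 6) = (4 / 3) `^ (d%:R / 12) :> R.
  have -> : 2 / Num.sqrt 3 = (4 / 3) `^ 2^-1 :> R.
    rewrite powR12_sqrt; last lra.
    rewrite -(ger0_norm (ler0n R 2)) -sqrtr_sqr -sqrtrV// -sqrtrM ?sqr_ge0//.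
    by congr Num.sqrt; lra.
  by rewrite -powRrM; congr (_ `^ _); field.
have [d34|d35] := leqP d 34; first by apply: le_trans c2; exact: small_d_bound.
(* In large dimension the leading factor, at most 1, is simply dropped. *)
apply: (@le_trans _ _ ((4 / 3) `^ (d%:R / 12))).
  rewrite ler_piMl ?powR_ge0// invf_le1 ?lerDl.
    by rewrite mulr_ge0 ?sqrtr_ge0// divr_ge0 ?sqrtr_ge0// mulr_ge0 ?sqrtr_ge0.
  by rewrite ltr_pwDl// mulr_ge0 ?sqrtr_ge0// divr_ge0 ?sqrtr_ge0// mulr_ge0 ?sqrtr_ge0.
have := weak_type11_large_dim mu_fin mu0 d35 wc.
have q0 : 0 < (3 / 4) `^ (d%:R / 12) :> R by apply: powR_gt0; lra.
rewrite -ler_pdivrMr// => /(le_trans _); apply.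
rewrite ler_pdivlMr// -powRM; try lra.
by rewrite (_ : 4 / 3 * (3 / 4) = 1) ?powR1//; field.
Qed.
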